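(* Let $\Lambda \subset \mathbb{R}^n$ be a lattice with basis $B=\{\vec{v}_1,\ldots,\vec{v}_m\}$, where $m \leq n$. Then $\Lambda$ is cyclic if and only if $\rho(\vec{v}_i)\in\Lambda$ for every $\vec{v}_i\in B$.
   Context: A lattice $\Lambda\subset\mathbb{R}^n$ is the set of all integer linear combinations of a finite family of $\mathbb{R}$-linearly independent vectors of $\mathbb{R}^n$ (a basis of $\Lambda$); it need not have full rank. The shift operator is the linear map $\rho:\mathbb{R}^n\to\mathbb{R}^n$, $\rho(c_1,\dots,c_n)=(c_n,c_1,\dots,c_{n-1})$. A lattice $\Lambda\subset\mathbb{R}^n$ (of any rank) is called cyclic if $\rho(\Lambda)=\Lambda$. *)

(* Defs.v *)
From HB Require Import structures.
From mathcomp Require Import all_boot all_order all_algebra.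
From mathcomp Require Import boolp classical_sets reals.

Set Implicit Arguments.
Unset Strict Implicit.
Unset Printing Implicit Defensive.

Import GRing.Theory.
Local Open Scope classical_set_scope.
Local Open Scope ring_scope.

(* Coordinates are indexed from 0; [ord_pred j] is j - 1 modulo n, so this is
   (c_0, ..., c_(n-1)) |-> (c_(n-1), c_0, ..., c_(n-2)). *)
Definition shift (R : realType) (n : nat) (x : 'rV[R]_n) : 'rV[R]_n :=
  \row_(j < n) x 0 (ord_pred j).

Definition int_span (R : realType) (n m : nat) (B : m.-tuple 'rV[R]_n) :
    set 'rV[R]_n :=
  [set x | exists c : 'I_m -> int, x = \sum_(i < m) (c i)%:~R *: tnth B i].

Definition lattice_basis (R : realType) (n m : nat) (B : m.-tuple 'rV[R]_n)
    (L : set 'rV[R]_n) : Prop :=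
  free B /\ L = int_span B.

Definition is_lattice (R : realType) (n : nat) (L : set 'rV[R]_n) : Prop :=
  exists (m : nat) (B : m.-tuple 'rV[R]_n), lattice_basis B L.

Definition cyclic_lattice (R : realType) (n : nat) (L : set 'rV[R]_n) : Prop :=
  is_lattice L /\ @shift R n @` L = L.

(* Main.v *)
Require Import Defs.
From HB Require Import structures.
From mathcomp Require Import all_boot all_order all_algebra.
From mathcomp Require Import fingroup perm.
From mathcomp Require Import boolp classical_sets reals.

Import GRing.Theory.
Local Open Scope classical_set_scope.
Local Open Scope ring_scope.

(* The shift has finite order, so if it maps a set L into itself, then every x
   in L is the shift of some iterated shift of x, which again lies in L. *)

(** A lattice is closed under integer combinations ([int_span_comb]) and [shift] is linear, so once
    the basis vectors are sent into [L], all of [L] is. Finite order ([iter_shift_id]) upgrades this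
    inclusion to equality in [shift_image_id]. Conversely, basis vectors lie in [L], so cyclicity
    puts their shifts in [L]. *)

Lemma iter_ord_pred_id (n : nat) :
  exists k : nat, forall j : 'I_n, iter k.+1 (@ord_pred n) j = j.
Proof.
pose p := perm (@ord_pred_inj n).
(* The exponent is the order of [p] in the symmetric group, which is positive even when [n = 0]. *)
exists #[p]%g.-1 => j; rewrite prednK ?order_gt0 //.
transitivity (iter #[p]%g p j); last by rewrite -permX expg_order perm1.
by apply: eq_iter => i; rewrite permE.
Qed.

Lemma iter_shiftE (R : realType) (n k : nat) (x : 'rV[R]_n) (j : 'I_n) :
  iter k (@shift R n) x 0 j = x 0 (iter k (@ord_pred n) j).
Proof. by elim: k j => [|k IHk] j //=; rewrite mxE IHk -iterSr. Qed.

Lemma iter_shift_id (R : realType) (n : nat) :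
  exists k : nat, forall x : 'rV[R]_n, iter k.+1 (@shift R n) x = x.
Proof.
have [k kP] := iter_ord_pred_id n.
by exists k => x; apply/rowP => j; rewrite iter_shiftE kP.
Qed.

Lemma shift_is_linear (R : realType) (n : nat) : linear (@shift R n).
Proof. by move=> a x y; apply/rowP => j; rewrite !mxE. Qed.

(** Makes [linear_sum] and [linearZ] applicable to [shift]. *)
HB.instance Definition _ (R : realType) (n : nat) :=
  GRing.isLinear.Build R 'rV[R]_n 'rV[R]_n _ (@shift R n)
    (@shift_is_linear R n).

Lemma shift_image_id (R : realType) (n : nat) (L : set 'rV[R]_n) :
  (forall x, L x -> L (shift x)) -> @shift R n @` L = L.
Proof.
move=> Lshift; apply/seteqP; split=> [_ [x Lx <-]|x Lx]; first exact: Lshift.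
have [k kP] := iter_shift_id R n.
exists (iter k (@shift R n) x); last by rewrite -iterS kP.
by elim: k {kP} => //= k; apply: Lshift.
Qed.

Lemma int_span_tnth (R : realType) (n m : nat) (B : m.-tuple 'rV[R]_n)
  (i : 'I_m) : int_span B (tnth B i).
Proof.
exists (fun j => (j == i)%:Z).
rewrite (bigD1 i) //= eqxx scale1r big1 ?addr0 // => j /negPf ->.
by rewrite scale0r.
Qed.

Lemma int_span_comb (R : realType) (n m k : nat) (B : m.-tuple 'rV[R]_n)
    (c : 'I_k -> int) (v : 'I_k -> 'rV[R]_n) :
  (forall i, int_span B (v i)) -> int_span B (\sum_i (c i)%:~R *: v i).
Proof.
(* Row [d i] holds chosen integer coordinates of [v i] in [B]; the combination then has as
   coordinates the row vector [c] times the matrix [d]. *)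
move=> /choice[d dP]; exists (fun j => \sum_i c i * d i j).
under eq_bigr => i _ do rewrite dP scaler_sumr.
rewrite exchange_big; apply: eq_bigr => j _.
rewrite rmorph_sum scaler_suml; apply: eq_bigr => i _.
by rewrite scalerA rmorphM.
Qed.

Theorem theorem1 (R : realType) (n m : nat) (hmn : (m <= n)%N)
    (L : set 'rV[R]_n) (B : m.-tuple 'rV[R]_n) (hB : lattice_basis B L) :
  cyclic_lattice L <-> (forall v : 'rV[R]_n, v \in B -> L (shift v)).
Proof.
have [_ LE] := hB; split=> [[_ shiftL] v /tnthP[i ->]|shiftB].
  (* Replacing [L] by its image under [shift] leaves only the basis vector itself to be placed in
     [L]. *)
  by rewrite -shiftL; exists (tnth B i) => //; rewrite LE; apply: int_span_tnth.
split; first by exists m, B.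
apply: shift_image_id => x; rewrite LE => -[c ->].
rewrite linear_sum; under eq_bigr do rewrite linearZ.
by apply: int_span_comb => i; rewrite -LE; apply/shiftB/mem_tnth.
Qed.
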